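(* Suppose that $x_0,\dots,x_N\in\mathbb{R}^{n_x}$, $u_0,\dots,u_{N-1}\in\mathbb{R}^{n_u}$, $\lambda_0,\dots,\lambda_N\in\mathbb{R}^{n_x}$ and $\nu\in\mathbb{R}^{n_c}$ satisfy the second-order sufficient conditions (SOSC) of the transformed optimal control problem. Then the solution $x_0,\dots,x_N$, $u_0,\dots,u_{N-1}$ is a strict local minimum of the original optimal control problem.
   Context: Notation. Subscripts denote partial derivatives: $h_x$ is the Jacobian of $h$ with respect to $x$ (a row vector if $h$ is scalar-valued), and for scalar $h$, $h_{xx},h_{xu},h_{uu}$ are the blocks of second partial derivatives. Data. Let $n,n_u,n_c,N,k$ be positive integers with $n_u\le n$, $n_c\le n$, $k\ge 2$, where $k$ is one of the time stages $0,\dots,N$ (so $2\le k\le N$, the terminal stage $k=N$ being allowed), and let $n_x=2n$. States are written $x=\begin{bmatrix} q^{\rm T} & v^{\rm T}\end{bmatrix}^{\rm T}\in\mathbb{R}^{n_x}$ with $q,v\in\mathbb{R}^n$ (generalized coordinates and velocity). The functions $\varphi:\mathbb{R}^{n_x}\to\mathbb{R}$, $L:\mathbb{R}^{n_x}\times\mathbb{R}^{n_u}\to\mathbb{R}$, $f:\mathbb{R}^{n_x}\times\mathbb{R}^{n_u}\to\mathbb{R}^{n_x}$, $\phi:\mathbb{R}^{n_x}\to\mathbb{R}^{n_c}$ are twice continuously differentiable, and $\bar x\in\mathbb{R}^{n_x}$ is given. The function $f$ has the form $$f(x,u)=\begin{bmatrix} f^{(q)}(x)\\ f^{(v)}(x,u)\end{bmatrix},\qquad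 f^{(q)}(x),\,f^{(v)}(x,u)\in\mathbb{R}^n,$$ and $\phi$ depends only on the generalized coordinate, i.e. $\phi_x(x)=\begin{bmatrix}\phi_q(q) & O\end{bmatrix}$ with $\phi_q(q)\in\mathbb{R}^{n_c\times n}$. Define $g(x):=\begin{bmatrix} f^{(q)}(x)\\ 0\end{bmatrix}\in\mathbb{R}^{n_x}$. Original optimal control problem: find $x_0,\dots,x_N$, $u_0,\dots,u_{N-1}$ minimizing $J=\varphi(x_N)+\sum_{i=0}^{N-1}L(x_i,u_i)$ subject to (a) $x_i+f(x_i,u_i)-x_{i+1}=0$ for $i\in\{0,\dots,N-1\}$; (b) $x_0-\bar x=0$; (c) $\phi(x_k)=0$. A strict local minimum of the original problem is a point $(x_0,\dots,x_N,u_0,\dots,u_{N-1})$ satisfying (a), (b), (c) that has a neighborhood in which every other point satisfying (a), (b), (c) has a strictly larger value of $J$. Transformed optimal control problem: minimize the same $J$ subject to (a), (b) and, in place of (c), (c') $\phi\bigl(x_{k-2}+f(x_{k-2},u_{k-2})+g(x_{k-2}+f(x_{k-2},u_{k-2}))\bigr)=0$. Hamiltonians: $H(x,u,\lambda):=L(x,u)+\lambda^{\rm T}f(x,u)$ and $\tilde H(x,u,\lambda,\nu):=H(x,u,\lambda)+\nu^{\rm T}\phi\bigl(x+f(x,u)+g(x+f(x,u))\bigr)$. FONC (first-order necessary conditions) of the transformed problem (for $x_i,u_i,\lambda_i,\nu$): the constraints (a), (b), (c') hold, and - $\varphi_x^{\rm T}(x_N)-\lambda_N=0$; - $H_x^{\rm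 T}(x_i,u_i,\lambda_{i+1})+\lambda_{i+1}-\lambda_i=0$ and $H_u^{\rm T}(x_i,u_i,\lambda_{i+1})=0$ for all $i\in\{0,\dots,N-1\}\setminus\{k-2\}$; - $\tilde H_x^{\rm T}(x_{k-2},u_{k-2},\lambda_{k-1},\nu)+\lambda_{k-1}-\lambda_{k-2}=0$ and $\tilde H_u^{\rm T}(x_{k-2},u_{k-2},\lambda_{k-1},\nu)=0$. SOSC of the transformed problem (for $x_i,u_i,\lambda_i,\nu$): the FONC of the transformed problem hold, and $$\delta x_N^{\rm T}Q_{xx,N}\delta x_N+\sum_{i=0}^{N-1}\begin{bmatrix}\delta x_i\\ \delta u_i\end{bmatrix}^{\rm T}\begin{bmatrix}Q_{xx,i}&Q_{xu,i}\\ Q_{xu,i}^{\rm T}&Q_{uu,i}\end{bmatrix}\begin{bmatrix}\delta x_i\\ \delta u_i\end{bmatrix}>0$$ for all $(\delta x_0,\dots,\delta x_N,\delta u_0,\dots,\delta u_{N-1})$, not all zero, satisfying $\delta x_0=0$, $(I+f_x(x_i,u_i))\delta x_i+f_u(x_i,u_i)\delta u_i-\delta x_{i+1}=0$ for $i\in\{0,\dots,N-1\}$, and $\phi_x(I+g_x)(I+f_x(x_{k-2},u_{k-2}))\delta x_{k-2}+\phi_x(I+g_x)f_u(x_{k-2},u_{k-2})\delta u_{k-2}=0$. Here $g_x$ is evaluated at $x_{k-2}+f(x_{k-2},u_{k-2})$ and $\phi_x$ at $x_{k-2}+f(x_{k-2},u_{k-2})+g(x_{k-2}+f(x_{k-2},u_{k-2}))$.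 The matrices are $Q_{xx,N}=\varphi_{xx}(x_N)$; for $i\in\{0,\dots,N-1\}\setminus\{k-2\}$, $Q_{xx,i},Q_{xu,i},Q_{uu,i}$ are $H_{xx},H_{xu},H_{uu}$ at $(x_i,u_i,\lambda_{i+1})$; for $i=k-2$ they are $\tilde H_{xx},\tilde H_{xu},\tilde H_{uu}$ at $(x_{k-2},u_{k-2},\lambda_{k-1},\nu)$. *)

(* Defs.v *)
From HB Require Import structures.
From mathcomp Require Import all_boot all_order all_algebra.
From mathcomp Require Import boolp classical_sets functions reals.
From mathcomp Require Import topology normedtype derive.

Set Implicit Arguments.
Unset Strict Implicit.
Unset Printing Implicit Defensive.

Import Order.TTheory GRing.Theory Num.Theory.
Import numFieldNormedType.Exports.

Local Open Scope ring_scope.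

(* Vectors are columns; a state of R^{2n} is [col_mx q v : 'cV[R]_(n + n)], so
   its generalized coordinate is [usubmx x] and its velocity [dsubmx x]. *)

(* On the finite-dimensional spaces used here, continuity of x |-> 'D_v F x for
   every fixed direction v is the same as continuity of x |-> 'd F x. *)
Definition C1 (R : realType) (V W : normedModType R) (F : V -> W) : Prop :=
  (forall x, differentiable F x) /\ (forall v, continuous ('D_v F)).

Definition C2 (R : realType) (V W : normedModType R) (F : V -> W) : Prop :=
  C1 F /\ (forall v, C1 ('D_v F)).

Definition evec (R : realType) (m : nat) (j : 'I_m) : 'cV[R]_m := delta_mx j 0.

Definition grad (R : realType) (m : nat) (h : 'cV[R]_m -> R) (x : 'cV[R]_m) :
    'rV[R]_m :=
  \row_j 'D_(evec R j) h x.

(* The usual p x m Jacobian, acting on columns from the left; the library's 'J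
   is for row vectors and is its transpose. *)
Definition jac (R : realType) (m p : nat) (F : 'cV[R]_m -> 'cV[R]_p)
    (x : 'cV[R]_m) : 'M[R]_(p, m) :=
  \matrix_(i, j) 'D_(evec R j) (fun y => F y i 0) x.

Definition hess (R : realType) (m : nat) (h : 'cV[R]_m -> R) (x : 'cV[R]_m) :
    'M[R]_m :=
  \matrix_(i, j) 'D_(evec R i) (fun y => 'D_(evec R j) h y) x.

(* h_{xu}: the (i, j) entry is d^2 h / dx_i du_j. *)
Definition mixed_hess (R : realType) (m p : nat)
    (h : 'cV[R]_m -> 'cV[R]_p -> R) (x : 'cV[R]_m) (u : 'cV[R]_p) :
    'M[R]_(m, p) :=
  \matrix_(i, j) 'D_(evec R i) (fun y => 'D_(evec R j) (h y) u) x.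

Definition dotc (R : realType) (m : nat) (a b : 'cV[R]_m) : R :=
  (a^T *m b) 0 0.

Definition qform (R : realType) (m : nat) (Q : 'M[R]_m) (z : 'cV[R]_m) : R :=
  (z^T *m Q *m z) 0 0.

(* For i in {0, ..., N-1}, the indices i and i+1 in {0, ..., N}. *)
Definition cur (N : nat) (i : 'I_N) : 'I_N.+1 := widen_ord (leqnSn N) i.
Definition nxt (N : nat) (i : 'I_N) : 'I_N.+1 := lift ord0 i.

Lemma stage_subproof (N k : nat) : (2 <= k <= N)%N -> (k < N.+1)%N.
Proof. by case/andP. Qed.

Lemma stage2_subproof (N k : nat) : (2 <= k <= N)%N -> (k - 2 < N)%N.
Proof.
by case/andP=> k2 kN; rewrite (leq_trans _ kN) // ltn_subrL (ltnW k2).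
Qed.

(* The state stage k in {0, ..., N}, and k-2 in {0, ..., N-1}. *)
Definition stage (N k : nat) (hk : (2 <= k <= N)%N) : 'I_N.+1 :=
  Ordinal (stage_subproof hk).
Definition stage2 (N k : nat) (hk : (2 <= k <= N)%N) : 'I_N :=
  Ordinal (stage2_subproof hk).

Definition g_of (R : realType) (n : nat) (fq : 'cV[R]_(n + n) -> 'cV[R]_n)
    (x : 'cV[R]_(n + n)) : 'cV[R]_(n + n) :=
  col_mx (fq x) 0.

Definition cost (R : realType) (nx nu N : nat)
    (varphi : 'cV[R]_nx -> R) (L : 'cV[R]_nx -> 'cV[R]_nu -> R)
    (x : 'I_N.+1 -> 'cV[R]_nx) (u : 'I_N -> 'cV[R]_nu) : R :=
  varphi (x ord_max) + \sum_(i < N) L (x (cur i)) (u i).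

Definition dynamics (R : realType) (nx nu N : nat)
    (f : 'cV[R]_nx -> 'cV[R]_nu -> 'cV[R]_nx) (xbar : 'cV[R]_nx)
    (x : 'I_N.+1 -> 'cV[R]_nx) (u : 'I_N -> 'cV[R]_nu) : Prop :=
  (forall i : 'I_N, x (cur i) + f (x (cur i)) (u i) - x (nxt i) = 0) /\
  x ord0 - xbar = 0.

Definition feasible (R : realType) (nx nu nc N k : nat)
    (hk : (2 <= k <= N)%N)
    (f : 'cV[R]_nx -> 'cV[R]_nu -> 'cV[R]_nx)
    (phi : 'cV[R]_nx -> 'cV[R]_nc) (xbar : 'cV[R]_nx)
    (x : 'I_N.+1 -> 'cV[R]_nx) (u : 'I_N -> 'cV[R]_nu) : Prop :=
  dynamics f xbar x u /\ phi (x (stage hk)) = 0.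

(* The boxes of radius e form a base of neighborhoods of (x, u). *)
Definition strict_local_min (R : realType) (nx nu nc N k : nat)
    (hk : (2 <= k <= N)%N)
    (varphi : 'cV[R]_nx -> R) (L : 'cV[R]_nx -> 'cV[R]_nu -> R)
    (f : 'cV[R]_nx -> 'cV[R]_nu -> 'cV[R]_nx)
    (phi : 'cV[R]_nx -> 'cV[R]_nc) (xbar : 'cV[R]_nx)
    (x : 'I_N.+1 -> 'cV[R]_nx) (u : 'I_N -> 'cV[R]_nu) : Prop :=
  feasible hk f phi xbar x u /\
  exists2 e : R, 0 < e &
    forall (x' : 'I_N.+1 -> 'cV[R]_nx) (u' : 'I_N -> 'cV[R]_nu),
      (forall i, `|x' i - x i| < e) -> (forall i, `|u' i - u i| < e) ->
      feasible hk f phi xbar x' u' ->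
      ~ ((forall i, x' i = x i) /\ (forall i, u' i = u i)) ->
      cost varphi L x u < cost varphi L x' u'.

(* By [dynamics], with x = x_{k-2} and u = u_{k-2} this is
   x_{k-1} + g(x_{k-1}), which has the same generalized coordinate as x_k. *)
Definition shifted (R : realType) (nx nu : nat)
    (f : 'cV[R]_nx -> 'cV[R]_nu -> 'cV[R]_nx) (g : 'cV[R]_nx -> 'cV[R]_nx)
    (x : 'cV[R]_nx) (u : 'cV[R]_nu) : 'cV[R]_nx :=
  x + f x u + g (x + f x u).

Definition feasible_transformed (R : realType) (nx nu nc N k : nat)
    (hk : (2 <= k <= N)%N)
    (f : 'cV[R]_nx -> 'cV[R]_nu -> 'cV[R]_nx) (g : 'cV[R]_nx -> 'cV[R]_nx)
    (phi : 'cV[R]_nx -> 'cV[R]_nc) (xbar : 'cV[R]_nx)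
    (x : 'I_N.+1 -> 'cV[R]_nx) (u : 'I_N -> 'cV[R]_nu) : Prop :=
  dynamics f xbar x u /\
  phi (shifted f g (x (cur (stage2 hk))) (u (stage2 hk))) = 0.

Definition Ham (R : realType) (nx nu : nat)
    (L : 'cV[R]_nx -> 'cV[R]_nu -> R)
    (f : 'cV[R]_nx -> 'cV[R]_nu -> 'cV[R]_nx)
    (lam : 'cV[R]_nx) (x : 'cV[R]_nx) (u : 'cV[R]_nu) : R :=
  L x u + dotc lam (f x u).

Definition Ham_tilde (R : realType) (nx nu nc : nat)
    (L : 'cV[R]_nx -> 'cV[R]_nu -> R)
    (f : 'cV[R]_nx -> 'cV[R]_nu -> 'cV[R]_nx) (g : 'cV[R]_nx -> 'cV[R]_nx)
    (phi : 'cV[R]_nx -> 'cV[R]_nc)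
    (lam : 'cV[R]_nx) (mult : 'cV[R]_nc) (x : 'cV[R]_nx) (u : 'cV[R]_nu) : R :=
  Ham L f lam x u + dotc mult (phi (shifted f g x u)).

Definition stage_Ham (R : realType) (nx nu nc N k : nat)
    (hk : (2 <= k <= N)%N)
    (L : 'cV[R]_nx -> 'cV[R]_nu -> R)
    (f : 'cV[R]_nx -> 'cV[R]_nu -> 'cV[R]_nx) (g : 'cV[R]_nx -> 'cV[R]_nx)
    (phi : 'cV[R]_nx -> 'cV[R]_nc)
    (lam : 'I_N.+1 -> 'cV[R]_nx) (mult : 'cV[R]_nc) (i : 'I_N) :
    'cV[R]_nx -> 'cV[R]_nu -> R :=
  if i == stage2 hk then Ham_tilde L f g phi (lam (nxt i)) mult
  else Ham L f (lam (nxt i)).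

Definition FONC_transformed (R : realType) (nx nu nc N k : nat)
    (hk : (2 <= k <= N)%N)
    (varphi : 'cV[R]_nx -> R) (L : 'cV[R]_nx -> 'cV[R]_nu -> R)
    (f : 'cV[R]_nx -> 'cV[R]_nu -> 'cV[R]_nx) (g : 'cV[R]_nx -> 'cV[R]_nx)
    (phi : 'cV[R]_nx -> 'cV[R]_nc) (xbar : 'cV[R]_nx)
    (x : 'I_N.+1 -> 'cV[R]_nx) (u : 'I_N -> 'cV[R]_nu)
    (lam : 'I_N.+1 -> 'cV[R]_nx) (mult : 'cV[R]_nc) : Prop :=
  [/\ feasible_transformed hk f g phi xbar x u,
      (grad varphi (x ord_max))^T - lam ord_max = 0,
      (forall i : 'I_N,
         (grad (fun y => stage_Ham hk L f g phi lam mult i y (u i))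
               (x (cur i)))^T + lam (nxt i) - lam (cur i) = 0) &
      (forall i : 'I_N,
         (grad (stage_Ham hk L f g phi lam mult i (x (cur i))) (u i))^T = 0)].

Definition Qblock (R : realType) (nx nu : nat)
    (h : 'cV[R]_nx -> 'cV[R]_nu -> R) (x : 'cV[R]_nx) (u : 'cV[R]_nu) :
    'M[R]_(nx + nu) :=
  block_mx (hess (h^~ u) x) (mixed_hess h x u)
           (mixed_hess h x u)^T (hess (h x) u).

Definition SOSC_transformed (R : realType) (nx nu nc N k : nat)
    (hk : (2 <= k <= N)%N)
    (varphi : 'cV[R]_nx -> R) (L : 'cV[R]_nx -> 'cV[R]_nu -> R)
    (f : 'cV[R]_nx -> 'cV[R]_nu -> 'cV[R]_nx) (g : 'cV[R]_nx -> 'cV[R]_nx)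
    (phi : 'cV[R]_nx -> 'cV[R]_nc) (xbar : 'cV[R]_nx)
    (x : 'I_N.+1 -> 'cV[R]_nx) (u : 'I_N -> 'cV[R]_nu)
    (lam : 'I_N.+1 -> 'cV[R]_nx) (mult : 'cV[R]_nc) : Prop :=
  let fx i := jac (f^~ (u i)) (x (cur i)) in
  let fu i := jac (f (x (cur i))) (u i) in
  let k2 := stage2 hk in
  let gx := jac g (x (cur k2) + f (x (cur k2)) (u k2)) in
  let phix := jac phi (shifted f g (x (cur k2)) (u k2)) in
  FONC_transformed hk varphi L f g phi xbar x u lam mult /\
  forall (dx : 'I_N.+1 -> 'cV[R]_nx) (du : 'I_N -> 'cV[R]_nu),
    ~ ((forall i, dx i = 0) /\ (forall i, du i = 0)) ->
    dx ord0 = 0 ->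
    (forall i : 'I_N,
       (1%:M + fx i) *m dx (cur i) + fu i *m du i - dx (nxt i) = 0) ->
    phix *m (1%:M + gx) *m (1%:M + fx k2) *m dx (cur k2)
      + phix *m (1%:M + gx) *m fu k2 *m du k2 = 0 ->
    0 < qform (hess varphi (x ord_max)) (dx ord_max)
        + \sum_(i < N)
            qform (Qblock (stage_Ham hk L f g phi lam mult i) (x (cur i)) (u i))
                  (col_mx (dx (cur i)) (du i)).

(* Main.v *)
Require Import Defs.
From HB Require Import structures.
From mathcomp Require Import all_boot all_order all_algebra.
From mathcomp Require Import boolp classical_sets functions reals.
From mathcomp Require Import topology normedtype derive.
From mathcomp Require Import landau prodnormedzmodule ring lra.

(* Given the dynamics, [x_k] and the shifted point have the same generalized
   coordinate, so both problems have the same feasible set and it suffices to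
   show that the SOSC of the transformed problem are sufficient. On a feasible
   displacement [d] the multiplier terms telescope, so the change of cost is
   [Q d] plus an [o(|d|^2)], where [Q] is half the quadratic form of the SOSC,
   while the linearized constraints [a d] are [o(|d|)]. The minimum of
   [max (Q d) (a d)] on the unit sphere is positive by the SOSC, and by
   homogeneity [Q d >= c |d|^2] for small feasible [d]. *)

Set Implicit Arguments.
Unset Strict Implicit.
Unset Printing Implicit Defensive.

Import Order.TTheory GRing.Theory Num.Theory.
Import numFieldNormedType.Exports.

Local Open Scope ring_scope.
Local Open Scope classical_set_scope.

(** The SOSC make [Q] positive only on the kernel of [a], while a feasible displacement is merely
    close to that kernel. The maximum turns this into a dichotomy with one constant [c]: either
    [Q d >= c |d|^2], or [a d >= c |d|], and the latter fails for small feasible [d], where [a d] is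
    itself a first-order remainder. Allowing each remainder at most half of [c] leaves a strict
    margin.

    The longer work is the expansion: the SOSC speak of blocks of iterated partial derivatives in
    [x] and [u], with one mixed block and its transpose, whereas the remainder must be small on the
    product space. The bridge is a Taylor estimate along chosen directions. *)

(** * Little-o remainders and the abstract sufficiency test *)

Definition negligible (R : realType) (V : normedModType R) (k : nat) (r : V -> R) :=
  forall e : R, 0 < e -> \forall p \near 0, `|r p| <= e * `|p| ^+ k.

Lemma negligible0 (R : realType) (V : normedModType R) k : negligible k (fun _ : V => 0 : R).
Proof.
move=> e e0; near=> p; rewrite normr0 mulr_ge0 ?exprn_ge0// ltW//.
Unshelve. all: by end_near. Qed.

Lemma negligibleD (R : realType) (V : normedModType R) k (r s : V -> R) :
  negligible k r -> negligible k s -> negligible k (fun p => r p + s p).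
Proof.
move=> hr hs e e0; have e2 : 0 < e / 2 by rewrite divr_gt0.
near=> p; rewrite [e]splitr mulrDl (le_trans (ler_normD _ _))// lerD//.
- by near: p; exact: hr.
- by near: p; exact: hs.
Unshelve. all: by end_near. Qed.

Lemma negligible_sum (R : realType) (V : normedModType R) k (I : finType)
    (r : I -> V -> R) :
  (forall i, negligible k (r i)) -> negligible k (fun p => \sum_i r i p).
Proof.
move=> hr; rewrite /index_enum; elim: (Finite.enum I) => [|i s ih].
  by under eq_fun do rewrite big_nil; exact: negligible0.
by under eq_fun do rewrite big_cons; exact: negligibleD.
Qed.

Lemma negligible_comp (R : realType) (V W : normedModType R) k (r : W -> R)
    (l : V -> W) :
  (forall p, `|l p| <= `|p|) -> negligible k r -> negligible k (r \o l).
Proof.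
move=> hl hr e e0; have /nbhs_ballP[d /= d0 hd] := hr e e0.
apply/nbhs_ballP; exists d => //= p; rewrite -ball_normE /= sub0r normrN => pd.
have /hd/le_trans : ball 0 d (l p).
  by rewrite -ball_normE /= sub0r normrN (le_lt_trans (hl p)).
by apply; rewrite ler_pM2l// lerXn2r ?nnegrE.
Qed.

Lemma negligible_diff (R : realType) (V W : normedModType R) (F : V -> W) (z : V) :
  differentiable F z ->
  negligible 1 (fun p => `|F (z + p) - F z - 'd F z p|).
Proof.
move=> dF e e0; have := diff_locallyxC dF.
move=> H; have /eqaddoP : F \o +%R z = (fun=> F z) + (fun p => 'd F z p) +o_ 0 id.
  by apply/eqaddoE/funext => p /=; rewrite H.
move=> /(_ e e0); apply: filterS => p.
by rewrite /= normr_id expr1 opprD addrA.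
Qed.

(** [F] is an arbitrary set: feasibility enters only through the two relations that tie [a] and [J]
    to the remainders. *)
Lemma second_order_sufficient (R : realType) (m : nat) (Q a : 'rV[R]_m -> R) :
  continuous Q -> continuous a ->
  (forall t d, Q (t *: d) = t ^+ 2 * Q d) ->
  (forall t d, a (t *: d) = `|t| * a d) ->
  (forall d, d != 0 -> a d = 0 -> 0 < Q d) ->
  (forall d, 0 <= a d) ->
  forall (J rem1 rem2 : 'rV[R]_m -> R) (F : 'rV[R]_m -> Prop),
  negligible 1 rem1 -> negligible 2 rem2 ->
  (forall d, F d -> a d <= `|rem1 d|) ->
  (forall d, F d -> J d = Q d + rem2 d) ->
  \forall d \near (0 : 'rV[R]_m), F d -> d != 0 -> 0 < J d.
Proof.
move=> cQ ca hQ ha Qpos a0 J rem1 rem2 F s1 s2 F1 F2.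
pose S := [set d : 'rV[R]_m | `|d| = 1].
have Sn (d : 'rV[R]_m) : d != 0 -> S (`|d|^-1 *: d).
  by move=> d0; rewrite /S /= normrZ normfV normr_id mulVf ?normr_eq0.
(* In dimension zero the sphere is empty and carries no minimum, but then there is no nonzero [d]
   either. *)
have [S0|S0] := pselect (S !=set0); last first.
  near=> d => _ d0; exfalso; apply: S0; exists (`|d|^-1 *: d); exact: Sn.
have cS : compact S.
  apply: bounded_closed_compact.
    exists 1; split; first exact: num_real.
    by move=> M M1 d /= ->; rewrite ltW.
  rewrite (_ : S = (fun d : 'rV[R]_m => `|d|) @^-1` [set 1]); last by [].
  apply: closed_comp; last exact: closed_eq.
  by move=> d _; exact: norm_continuous.
pose q d := Num.max (Q d) (a d).
have cq : continuous q by move=> d; apply: continuous_max; [exact: cQ|exact: ca].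
have [|d0 d0S dmin] := EVT_min_rV S0 cS (f := q).
  exact: continuous_subspaceT.
have d0n : d0 != 0.
  by rewrite -normr_eq0; rewrite inE /S /= in d0S; rewrite d0S oner_eq0.
have q0 : 0 < q d0.
  rewrite lt_max; have [/(Qpos _ d0n)->//|ad] := eqVneq (a d0) 0.
  by rewrite [0 < a d0]lt_neqAle eq_sym ad a0 orbT.
set c := q d0 in q0 dmin.
have c2 : 0 < c / 2 by rewrite divr_gt0.
near=> d => Fd dn; have nd : 0 < `|d| by rewrite normr_gt0.
(* The bound [c] at the normalized direction, scaled back by [|d|^2] in one branch and by [|d|] in
   the other. *)
have /orP[Qd|ad] : (c * `|d| ^+ 2 <= Q d) || (c * `|d| <= a d).
  have := dmin (`|d|^-1 *: d); rewrite inE => /(_ (Sn _ dn)).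
  rewrite /q le_max hQ ha exprVn ger0_norm ?invr_ge0//.
  by rewrite !ler_pdivlMl ?exprn_gt0// ![_ * c]mulrC.
- have : `|rem2 d| <= c / 2 * `|d| ^+ 2 by near: d; exact: s2.
  rewrite ler_norml => /andP[+ _]; rewrite F2//.
  have : 0 < c / 2 * `|d| ^+ 2 by rewrite mulr_gt0// exprn_gt0.
  set e := `|d| ^+ 2 in Qd *; lra.
(* Contradictory branch: [c |d| <= a d <= |rem1 d| <= c/2 |d|] with [d] nonzero. *)
- have : `|rem1 d| <= c / 2 * `|d| ^+ 1 by near: d; exact: s1.
  have : 0 < c / 2 * `|d| by rewrite mulr_gt0.
  rewrite expr1; move: (F1 _ Fd); lra.
Unshelve. all: by end_near. Qed.

(** * Max norms, continuity and derivatives along lines *)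

Lemma ler_norm_mx (R : realType) p q (A : 'M[R]_(p, q)) i j : `|A i j| <= `|A|.
Proof.
rewrite [leRHS]/Num.norm /= mx_normrE.
exact: (le_bigmax _ (fun i : 'I_p * 'I_q => `|A i.1 i.2|) (i, j)).
Qed.

Lemma mx_norm_le (R : realType) p q (A : 'M[R]_(p, q)) e :
  0 <= e -> (forall i j, `|A i j| <= e) -> `|A| <= e.
Proof.
by move=> e0 h; rewrite /Num.norm /= mx_normrE; apply/bigmax_leP; split.
Qed.

Lemma mx_norm_lt (R : realType) p q (A : 'M[R]_(p, q)) e :
  0 < e -> (forall i j, `|A i j| < e) -> `|A| < e.
Proof.
by move=> e0 h; rewrite /Num.norm /= mx_normrE; apply/bigmax_ltP; split.
Qed.

Lemma continuous_sum (R : realType) (V : topologicalType) (W : normedModType R)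
    (I : finType) (F : I -> V -> W) :
  (forall i, continuous (F i)) -> continuous (fun y => \sum_i F i y).
Proof.
by move=> cF; apply: continuous_big => [|i _]; [exact: add_continuous|exact: cF].
Qed.

(** The two difference quotients are the same function of the increment, so their limits agree
    without any question of convergence. *)
Lemma derive_affine (R : realType) (U V W : normedModType R) (h : V -> W)
    (G : U -> V) (x v : U) (v' : V) :
  (forall k : R, G (k *: v + x) = k *: v' + G x) ->
  'D_v (h \o G) x = 'D_v' h (G x).
Proof.
move=> GE; rewrite /derive.
set r := fun k : R => _; set s := fun k : R => _.
by have -> : r = s; first by apply/funext => k; rewrite /r /s /= GE.
Qed.

Lemma derivable_affine (R : realType) (U V W : normedModType R) (h : V -> W)
    (G : U -> V) (x v : U) (v' : V) :
  (forall k : R, G (k *: v + x) = k *: v' + G x) ->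
  derivable h (G x) v' -> derivable (h \o G) x v.
Proof.
move=> GE; rewrite /derivable.
set r := fun k : R => _; set s := fun k : R => _.
by have -> : r = s; first by apply/funext => k; rewrite /r /s /= GE.
Qed.

Lemma linear_mx_continuous (R : realType) p q (W : normedModType R)
    (l : {linear 'M[R]_(p, q) -> W}) : continuous l.
Proof.
have -> : l = (fun A : 'M[R]_(p, q) =>
    \sum_i \sum_j A i j *: l (delta_mx i j)) :> (_ -> _).
  apply/funext => A; rewrite {1}(matrix_sum_delta A) linear_sum.
  by apply: eq_bigr => i _; rewrite linear_sum; apply: eq_bigr => j _; rewrite linearZ.
apply: continuous_sum => i; apply: continuous_sum => j A.
by apply: cvgZr_tmp; [exact: nbhs_filter|exact: coord_continuous].
Qed.

(* First-order expansion of the derivative of [h] along the ray from [z + p] in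
   direction [w], integrated by the mean value theorem. Only directions in the
   span of [b] are differentiated, so that no symmetry of second derivatives
   is needed later. *)
Lemma taylor2_along (R : realType) (V : normedModType R) (h : V -> R) (z : V)
    (m : nat) (b : 'I_m -> V) :
  (forall y, differentiable h y) ->
  (forall j, differentiable ('D_(b j) h) z) ->
  forall e : R, 0 < e -> exists2 d : R, 0 < d &
  forall (p : V) (c : 'I_m -> R) (s : R),
    let w := \sum_j c j *: b j in
    s < d -> (forall j, `|c j| <= s) ->
    (forall t, 0 <= t <= 1 -> `|p + t *: w| <= s) ->
    `|h (z + p + w) - h (z + p) - 'd h z w
      - \sum_j c j * 'd ('D_(b j) h) z p
      - 2^-1 * \sum_j c j * 'd ('D_(b j) h) z w| <= e * s ^+ 2.
Proof.
move=> dh dD e e0.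
(* The [m] error terms below then add up to at most [e], and the divisor is nonzero even for
   [m = 0]. *)
have e'0 : 0 < e / m.+1%:R by rewrite divr_gt0.
have : \forall q \near (0 : V), forall j,
    `|'D_(b j) h (z + q) - 'D_(b j) h z - 'd ('D_(b j) h) z q|
      <= e / m.+1%:R * `|q|.
  apply: filter_forall => j.
  have := negligible_diff (dD j) e'0; apply: filterS => q.
  by rewrite normr_id expr1.
move=> /nbhs_ballP[d /= d0 hd]; exists d; first exact: d0.
move=> p c s; set w := \sum_j _ => sd cs ps.
set A := 'd h z w; set B := \sum_j _; set C := \sum_j _.
pose g (t : R) := z + p + t *: w.
(* [h] along the ray minus its expected quadratic in [t], so that [r 1 - r 0] is the quantity to
   bound; [B] accounts for the offset [p]. *)
pose r (t : R) := h (g t) - t * (A + B) - t ^+ 2 * (2^-1 * C).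
pose r' (t : R) := 'd h (g t) w - (A + B) - t * C.
have dr (t : R) : is_derive t (1 : R) r (r' t).
  have gE (k : R) : g (k *: 1 + t) = k *: w + g t.
    by rewrite /g scalerDl [k *: 1]mulr1 addrCA addrA.
  have dhg : is_derive t (1 : R) (h \o g) ('d h (g t) w).
    apply: DeriveDef; first by apply: (derivable_affine gE); exact: diff_derivable.
    by rewrite (derive_affine _ gE) deriveE.
  have -> : r = (h \o g) - (A + B) \*: (id : R -> R)
                - (2^-1 * C) \*: ((id : R -> R) ^+ 2).
    by apply/funext => a; rewrite /r /= !fctE /= /GRing.scale /=; ring.
  by apply: is_derive_eq; rewrite /r' /GRing.scale /= expr1; field.
have [|t t01] := @MVT R r r' 0 1 ltr01 (fun t _ => dr t).
  apply: continuous_subspaceT => t.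
  by apply: differentiable_continuous; apply/derivable1_diffP; case: (dr t).
rewrite subr0 mulr1 {1 2}/r /g scale1r scale0r addr0 !mul0r mul1r.
rewrite !expr1n expr0n /= !mul0r mul1r !subr0.
move=> E; rewrite (_ : _ - _ = r' t); last by rewrite -E; ring.
have t1 : 0 <= t <= 1 by move: t01; rewrite in_itv /= => /andP[? ?]; rewrite !ltW.
(* Since [w] lies in the span of the [b j], [r' t] is a combination of the linearization errors of
   the ['D_(b j) h] at [z], for the increment [p + t *: w]. *)
have -> : r' t = \sum_j c j * ('D_(b j) h (z + (p + t *: w)) - 'D_(b j) h z -
     'd ('D_(b j) h) z (p + t *: w)).
  have Ew y : 'd h y w = \sum_j c j * 'D_(b j) h y.
    by rewrite linear_sum; apply: eq_bigr => j _; rewrite linearZ /= deriveE.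
  have EBC : B + t * C = \sum_j c j * 'd ('D_(b j) h) z (p + t *: w).
    rewrite mulr_sumr -big_split; apply: eq_bigr => j _ /=.
    by rewrite linearD linearZ /= /GRing.scale /=; ring.
  rewrite (_ : r' t = 'd h (g t) w - A - (B + t * C)); last by rewrite /r'; ring.
  rewrite EBC /A /g -[z + p + _]addrA !Ew -!sumrB.
  by apply: eq_bigr => j _; ring.
rewrite (le_trans (ler_norm_sum _ _ _))//.
have s0 : 0 <= s by rewrite (le_trans _ (ps 0 _))// lexx ler01.
apply: (@le_trans _ _ (\sum_(j < m) (e / m.+1%:R * s ^+ 2))).
  apply: ler_sum => j _; rewrite normrM expr2 mulrCA.
  apply: ler_pM => //; apply: (le_trans (hd (p + t *: w) _ j)).
    by rewrite -ball_normE /= sub0r normrN (le_lt_trans (ps t t1)).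
  by rewrite ler_pM2l// ps.
rewrite sumr_const card_ord -mulrnAl ler_wpM2r ?exprn_ge0//.
rewrite -mulr_natr mulrAC ler_pdivrMr// ler_pM2l// ler_nat//.
Qed.

(** * Second-order expansions in gradients and Hessian blocks *)

(** The working regularity class: the form in which the Taylor estimates consume [C2], stable under
    the operations that build the Hamiltonians. *)
Definition twice_diff (R : realType) (V W : normedModType R) (F : V -> W) : Prop :=
  (forall z, differentiable F z) /\ (forall v z, differentiable ('D_v F) z).

Lemma cV_sum_evec (R : realType) m (c : 'cV[R]_m) :
  c = \sum_j c j 0 *: evec R j.
Proof.
rewrite {1}(matrix_sum_delta c); apply: eq_bigr => i _.
by rewrite big_ord1.
Qed.

Lemma gradE (R : realType) m (h : 'cV[R]_m -> R) (x c : 'cV[R]_m) :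
  (grad h x *m c) 0 0 = \sum_j c j 0 * 'D_(evec R j) h x.
Proof. by rewrite mxE; apply: eq_bigr => j _; rewrite mxE mulrC. Qed.

Lemma hessE (R : realType) m (h : 'cV[R]_m -> R) (x c : 'cV[R]_m) :
  qform (hess h x) c =
  \sum_j c j 0 * \sum_i c i 0 * 'D_(evec R i) ('D_(evec R j) h) x.
Proof.
rewrite /qform mxE; apply: eq_bigr => j _; rewrite mulrC mxE; congr (_ * _).
by apply: eq_bigr => i _; rewrite !mxE.
Qed.

Lemma prod_norm_le (R : realType) (V W : normedModType R) (v : V) (w : W) s :
  (`|(v, w)| <= s) = (`|v| <= s) && (`|w| <= s).
Proof. by rewrite prod_normE ge_max. Qed.

Definition taylor_rem (R : realType) (m : nat) (h : 'cV[R]_m -> R)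
    (x p : 'cV[R]_m) : R :=
  h (x + p) - h x - (grad h x *m p) 0 0 - 2^-1 * qform (hess h x) p.

Definition taylor_rem_pair (R : realType) (m p : nat)
    (h : 'cV[R]_m -> 'cV[R]_p -> R) (x : 'cV[R]_m) (u : 'cV[R]_p)
    (a : 'cV[R]_m) (c : 'cV[R]_p) : R :=
  h (x + a) (u + c) - h x u - (grad (h^~ u) x *m a) 0 0
  - (grad (h x) u *m c) 0 0 - 2^-1 * qform (Qblock h x u) (col_mx a c).

Lemma taylor2 (R : realType) (m : nat) (h : 'cV[R]_m -> R) (x : 'cV[R]_m) :
  twice_diff h ->
  negligible 2 (taylor_rem h x).
Proof.
move=> [dh dD] e e0.
have [d d0 hd] := taylor2_along dh (fun j => dD (evec R j) x) e0.
apply/nbhs_ballP; exists d => // p; rewrite -ball_normE /= sub0r normrN => pd.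
(* Zero offset, with [|p|] as the common bound on the coefficients and on the segment. *)
have := hd 0 (fun j => p j 0) `|p| pd.
rewrite -cV_sum_evec addr0 => /(_ (fun j => ler_norm_mx p j 0)).
have -> : \sum_j p j 0 * 'd ('D_(evec R j) h) x 0 = 0.
  by rewrite big1// => j _; rewrite linear0 mulr0.
rewrite subr0 /taylor_rem gradE hessE.
have Ew (f : 'cV[R]_m -> R) : differentiable f x ->
    'd f x p = \sum_i p i 0 * 'D_(evec R i) f x.
  move=> df; rewrite {1}(cV_sum_evec p) linear_sum; apply: eq_bigr => i _.
  by rewrite linearZ /= deriveE.
rewrite (Ew h)//; under [X in _ - 2^-1 * X]eq_bigr do rewrite Ew//.
apply=> t /andP[t0 t1]; rewrite add0r normrZ ger0_norm//.
by rewrite ler_piMl.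
Qed.

Lemma derive_fst (R : realType) (U V W : normedModType R) (H : U * V -> W) x u v :
  'D_v (fun y => H (y, u)) x = 'D_(v, 0) H (x, u).
Proof.
apply: (@derive_affine R U (U * V)%type W H (fun y => (y, u))) => k.
by congr pair => /=; rewrite scaler0 add0r.
Qed.

Lemma derive_snd (R : realType) (U V W : normedModType R) (H : U * V -> W) x u v :
  'D_v (fun y => H (x, y)) u = 'D_(0, v) H (x, u).
Proof.
apply: (@derive_affine R V (U * V)%type W H (fun y => (x, y))) => k.
by congr pair => /=; rewrite scaler0 add0r.
Qed.

Lemma mixed_hessE (R : realType) (m p : nat) (h : 'cV[R]_m -> 'cV[R]_p -> R)
    (x : 'cV[R]_m) (u : 'cV[R]_p) (a : 'cV[R]_m) (c : 'cV[R]_p) :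
  (a^T *m mixed_hess h x u *m c) 0 0 =
  \sum_j c j 0 * \sum_i a i 0 *
    'D_(evec R i) (fun y => 'D_(evec R j) (h y) u) x.
Proof.
rewrite mxE; apply: eq_bigr => j _; rewrite mulrC mxE; congr (_ * _).
by apply: eq_bigr => i _; rewrite !mxE.
Qed.

(** The off-diagonal blocks contribute two transposed 1 x 1 matrices, hence equal numbers; this is
    the factor 2. *)
Lemma qform_Qblock (R : realType) (m p : nat) (h : 'cV[R]_m -> 'cV[R]_p -> R)
    (x : 'cV[R]_m) (u : 'cV[R]_p) (a : 'cV[R]_m) (c : 'cV[R]_p) :
  qform (Qblock h x u) (col_mx a c) =
  qform (hess (h^~ u) x) a + 2 * (a^T *m mixed_hess h x u *m c) 0 0
  + qform (hess (h x) u) c.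
Proof.
have trE : (c^T *m (mixed_hess h x u)^T *m a) 0 0
         = (a^T *m mixed_hess h x u *m c) 0 0.
  have -> : c^T *m (mixed_hess h x u)^T *m a = (a^T *m mixed_hess h x u *m c)^T.
    by rewrite !trmx_mul trmxK mulmxA.
  by rewrite mxE.
rewrite /qform /Qblock tr_col_mx mul_row_block mul_row_col !mulmxDl.
have DE (A B : 'M[R]_1) : (A + B) 0 0 = A 0 0 + B 0 0 by rewrite mxE.
by rewrite !DE trE; ring.
Qed.

Lemma pair_fst_sum (R : realType) (V : normedModType R) (m : nat) (c : 'cV[R]_m) :
  (c, 0) = \sum_j c j 0 *: (evec R j, 0) :> 'cV[R]_m * V.
Proof.
rewrite {1}(cV_sum_evec c) /index_enum; elim: (Finite.enum _) => [|i s ih].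
  by rewrite !big_nil.
rewrite !big_cons -ih; congr pair => /=.
by rewrite scaler0 addr0.
Qed.

Lemma pair_snd_sum (R : realType) (V : normedModType R) (m : nat) (c : 'cV[R]_m) :
  (0, c) = \sum_j c j 0 *: (0, evec R j) :> V * 'cV[R]_m.
Proof.
rewrite {1}(cV_sum_evec c) /index_enum; elim: (Finite.enum _) => [|i s ih].
  by rewrite !big_nil.
rewrite !big_cons -ih; congr pair => /=.
by rewrite scaler0 addr0.
Qed.

(* The increment is split as [h (x + dx) (u + du) - h (x + dx) u] plus
   [h (x + dx) u - h x u]; only the mixed derivative that occurs in [Qblock]
   appears this way. *)
Lemma taylor2_pair (R : realType) (m p : nat) (h : 'cV[R]_m -> 'cV[R]_p -> R)
    (x : 'cV[R]_m) (u : 'cV[R]_p) :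
  twice_diff (fun z : 'cV[R]_m * 'cV[R]_p => h z.1 z.2) ->
  negligible 2 (fun q : 'cV[R]_m * 'cV[R]_p => taylor_rem_pair h x u q.1 q.2).
Proof.
set H := fun z => _; move=> [dH dD] e e0.
have e2 : 0 < e / 2 by rewrite divr_gt0.
have [d1 d10 h1] := taylor2_along dH (fun j => dD (evec R j, 0) (x, u)) e2.
have [d2 d20 h2] := taylor2_along dH (fun j => dD (0, evec R j) (x, u)) e2.
apply/nbhs_ballP; exists (Num.min d1 d2); first by rewrite /= lt_min d10.
move=> q; rewrite -ball_normE /= sub0r normrN lt_min => /andP[qd1 qd2].
case: q qd1 qd2 => a c qd1 qd2.
have /andP[na nc] : (`|a| <= `|(a, c)|) && (`|c| <= `|(a, c)|).
  by rewrite -prod_norm_le.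
have Ea (f : 'cV[R]_m * 'cV[R]_p -> R) : differentiable f (x, u) ->
    'd f (x, u) (a, 0) = \sum_i a i 0 * 'D_(evec R i, 0) f (x, u).
  move=> df; rewrite pair_fst_sum linear_sum; apply: eq_bigr => i _.
  by rewrite linearZ /= deriveE.
have Ec (f : 'cV[R]_m * 'cV[R]_p -> R) : differentiable f (x, u) ->
    'd f (x, u) (0, c) = \sum_i c i 0 * 'D_(0, evec R i) f (x, u).
  move=> df; rewrite pair_snd_sum linear_sum; apply: eq_bigr => i _.
  by rewrite linearZ /= deriveE.
have {h1} := h1 0 (fun j => a j 0) _ qd1.
rewrite -pair_fst_sum addr0.
have -> : \sum_j a j 0 * 'd ('D_(evec R j, 0) H) (x, u) 0 = 0.
  by rewrite big1// => j _; rewrite linear0 mulr0.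
rewrite subr0 Ea//; under [X in _ - 2^-1 * X]eq_bigr do rewrite Ea//.
(* The increment in [u] starts from the point already displaced in [x], whence the offset
   [(a, 0)]. *)
move=> {}h1; have {h2} := h2 (a, 0) (fun j => c j 0) _ qd2.
rewrite -pair_snd_sum Ec//.
have -> : \sum_j c j 0 * 'd ('D_(0, evec R j) H) (x, u) (0, c)
  = \sum_j c j 0 * \sum_i c i 0 * 'D_(0, evec R i) ('D_(0, evec R j) H) (x, u).
  by apply: eq_bigr => j _; rewrite Ec.
(* The offset produces the mixed term, with coefficient 1; in the goal the factor 2 of
   [qform_Qblock] cancels [2^-1]. *)
have -> : \sum_j c j 0 * 'd ('D_(0, evec R j) H) (x, u) (a, 0)
  = \sum_j c j 0 * \sum_i a i 0 * 'D_(evec R i, 0) ('D_(0, evec R j) H) (x, u).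
  by apply: eq_bigr => j _; rewrite Ea.
move=> h2.
rewrite /taylor_rem_pair qform_Qblock !gradE !hessE mixed_hessE.
have e1 v y w : 'D_v (h^~ w) y = 'D_(v, 0) H (y, w) by rewrite -derive_fst.
have e2' v y w : 'D_v (h y) w = 'D_(0, v) H (y, w) by rewrite -derive_snd.
have e11 v w : 'D_w ('D_v (h^~ u)) x = 'D_(w, 0) ('D_(v, 0) H) (x, u).
  rewrite -(derive_fst ('D_(v, 0) H)).
  have -> : 'D_v (h^~ u) = (fun y => 'D_(v, 0) H (y, u)).
    by apply/funext => y; exact: e1.
  by [].
have e12 v w :
    'D_w (fun y => 'D_v (h y) u) x = 'D_(w, 0) ('D_(0, v) H) (x, u).
  rewrite -(derive_fst ('D_(0, v) H)).
  have -> : (fun y => 'D_v (h y) u) = (fun y => 'D_(0, v) H (y, u)).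
    by apply/funext => y; exact: e2'.
  by [].
have e22 v w : 'D_w ('D_v (h x)) u = 'D_(0, w) ('D_(0, v) H) (x, u).
  rewrite -(derive_snd ('D_(0, v) H)).
  have -> : 'D_v (h x) = (fun y => 'D_(0, v) H (x, y)).
    by apply/funext => y; exact: e2'.
  by [].
have {}h1 := h1 (fun j => le_trans (ler_norm_mx a j 0) na).
have {}h2 := h2 (fun j => le_trans (ler_norm_mx c j 0) nc).
rewrite /=.
have -> : \sum_j a j 0 * 'D_(evec R j) (h^~ u) x
  = \sum_i a i 0 * 'D_(evec R i, 0) H (x, u).
  by apply: eq_bigr => j _; congr (_ * _); exact: e1.
have -> : \sum_j c j 0 * 'D_(evec R j) (h x) u
  = \sum_i c i 0 * 'D_(0, evec R i) H (x, u).
  by apply: eq_bigr => j _; congr (_ * _); exact: e2'.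
have -> : \sum_j a j 0 * \sum_i a i 0 * 'D_(evec R i) ('D_(evec R j) (h^~ u)) x
  = \sum_j a j 0 * \sum_i a i 0 * 'D_(evec R i, 0) ('D_(evec R j, 0) H) (x, u).
  apply: eq_bigr => j _; apply: congr1; apply: eq_bigr => i _.
  exact: (congr1 _ (e11 (evec R j) (evec R i))).
have -> : \sum_j c j 0 * \sum_i a i 0 *
      'D_(evec R i) (fun y => 'D_(evec R j) (h y) u) x
  = \sum_j c j 0 * \sum_i a i 0 * 'D_(evec R i, 0) ('D_(0, evec R j) H) (x, u).
  apply: eq_bigr => j _; apply: congr1; apply: eq_bigr => i _.
  exact: (congr1 _ (e12 (evec R j) (evec R i))).
have -> : \sum_j c j 0 * \sum_i c i 0 * 'D_(evec R i) ('D_(evec R j) (h x)) u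
  = \sum_j c j 0 * \sum_i c i 0 * 'D_(0, evec R i) ('D_(0, evec R j) H) (x, u).
  apply: eq_bigr => j _; apply: congr1; apply: eq_bigr => i _.
  exact: (congr1 _ (e22 (evec R j) (evec R i))).
move: h1 h2.
have -> : ((x, u) + (a, 0) + (0, c) : 'cV[R]_m * 'cV[R]_p) = (x + a, u + c).
  by congr pair; rewrite /= ?addr0.
have -> : ((x, u) + (a, 0) : 'cV[R]_m * 'cV[R]_p) = (x + a, u).
  by congr pair; rewrite /= addr0.
set s := `|(a, c)| in na nc *.
set S1 := \sum_i _; set S2 := \sum_i _; set S3 := \sum_i _.
set S4 := \sum_i _; set S5 := \sum_i _; rewrite /H /= => h1 h2.
have tP (t : R) : 0 <= t <= 1 -> `|t| <= 1.
  by move=> /andP[t0 t1]; rewrite ger0_norm.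
rewrite [e in leRHS]splitr [leRHS]mulrDl.
suff: `|h (x + a) u - h x u - S1 - 2^-1 * S2| <= e / 2 * s ^+ 2 /\
      `|h (x + a) (u + c) - h (x + a) u - S3 - S4 - 2^-1 * S5|
        <= e / 2 * s ^+ 2.
  move: (h (x + a) (u + c)) (h (x + a) u) (h x u) => X Y Z [k1 k2].
  apply: (le_trans _ (lerD k1 k2)).
  move: S1 S2 S3 S4 S5 {h1 h2 k1 k2} => S1 S2 S3 S4 S5.
  rewrite (_ : X - Z - _ - _ - _ = (Y - Z - S1 - 2^-1 * S2)
     + (X - Y - S3 - S4 - 2^-1 * S5)); last by clear; field.
  exact: ler_normD.
(* The product norm is a maximum, so both segments, [(t a, 0)] and [(a, t c)], stay within [s]. *)
split.
- apply: h1 => t /tP t1; rewrite add0r (_ : t *: _ = (t *: a, 0)).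
    rewrite prod_norm_le normr0 normrZ.
    by rewrite (le_trans _ na) ?ler_piMl ?(le_trans _ na).
  by congr pair; rewrite /= scaler0.
- apply: h2 => t /tP t1; rewrite (_ : _ + t *: _ = (a, t *: c)).
    by rewrite prod_norm_le na normrZ (le_trans _ nc) ?ler_piMl.
  by congr pair; rewrite /= ?scaler0 ?addr0 ?add0r.
Qed.

(** * Stability of twice differentiability *)

Lemma C2_twice_diff (R : realType) (V W : normedModType R) (F : V -> W) : C2 F -> twice_diff F.
Proof. by move=> [[dF _] CD]; split=> // v z; have [dD _] := CD v; exact: dD. Qed.

Lemma twice_diffD (R : realType) (V W : normedModType R) (F G : V -> W) :
  twice_diff F -> twice_diff G -> twice_diff (fun z => F z + G z).
Proof.
move=> [dF DF] [dG DG]; split=> [z|v z]; first exact: differentiableD.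
have -> : 'D_v (fun z => F z + G z) = 'D_v F + 'D_v G.
  by apply/funext => y; apply: deriveD; exact: diff_derivable.
exact: differentiableD.
Qed.

Lemma twice_diff_linear_comp (R : realType) (U V W : normedModType R)
    (l : {linear V -> W}) (F : U -> V) :
  continuous l -> twice_diff F -> twice_diff (l \o F).
Proof.
move=> cl [dF DF].
have dl z : differentiable l z by exact: linear_differentiable.
split=> [z|v z]; first exact: differentiable_comp.
have -> : 'D_v (l \o F) = l \o 'D_v F.
  apply/funext => y /=; rewrite deriveE; last exact: differentiable_comp.
  by rewrite diff_comp//= diff_lin//= deriveE.
exact: differentiable_comp.
Qed.

Lemma twice_diff_linear (R : realType) (V W : normedModType R) (l : {linear V -> W}) :
  continuous l -> twice_diff l.
Proof.
move=> cl; have dl z : differentiable l z by exact: linear_differentiable.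
split=> // v z; have -> : 'D_v l = cst (l v).
  by apply/funext => y; rewrite deriveE// diff_lin.
exact: differentiable_cst.
Qed.

(** [twice_diff] controls derivatives in fixed directions only, whereas the chain rule
    differentiates [F] in the direction ['D_v G z], which moves with [z]. Expanding that direction
    in the basis leaves finitely many fixed directions with differentiable coefficients. *)
Lemma twice_diff_comp (R : realType) (V : normedModType R) (m : nat)
    (F : 'cV[R]_m -> R) (G : V -> 'cV[R]_m) :
  twice_diff F -> twice_diff G -> twice_diff (F \o G).
Proof.
move=> [dF DF] [dG DG]; split=> [z|v z]; first exact: differentiable_comp.
have -> : 'D_v (F \o G) = \sum_(j < m)
    ((fun z => 'D_v G z j 0) * ('D_(evec R j) F \o G)).
  apply/funext => y; rewrite deriveE; last exact: differentiable_comp.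
  rewrite diff_comp//= -(deriveE v (dG y)) {1}(cV_sum_evec ('D_v G y)).
  rewrite linear_sum fct_sumE.
  by apply: eq_bigr => j _; rewrite linearZ /= -(deriveE (evec R j) (dF (G y))).
apply: differentiable_sum => j.
have dk : differentiable (fun z => 'D_v G z j 0) z.
  apply: (@differentiable_comp _ _ _ _ ('D_v G) (fun M : 'cV[R]_m => M j 0)) => //.
  exact: differentiable_coord.
by apply: differentiableM => //; exact: differentiable_comp.
Qed.

Lemma twice_diff_pairl (R : realType) (U V W : normedModType R) (F : U * V -> W) (u : V) :
  twice_diff F -> twice_diff (fun x => F (x, u)).
Proof.
move=> [dF DF].
have dG z : differentiable (fun x : U => (x, u)) z.
  by apply: differentiable_pair.
split=> [z|v z]; first exact: (differentiable_comp (dG z)).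
have -> : 'D_v (fun x => F (x, u)) = 'D_(v, 0) F \o (fun x => (x, u)).
  by apply/funext => y; rewrite derive_fst.
exact: differentiable_comp.
Qed.

Lemma twice_diff_linear_mx (R : realType) (V W : normedModType R) (p q : nat)
    (l : 'M[R]_(p, q) -> W) (F : V -> 'M[R]_(p, q)) :
  linear l -> twice_diff F -> twice_diff (fun z => l (F z)).
Proof.
move=> ll; pose lM := GRing.isLinear.Build _ _ _ _ _ ll.
pose L : {linear _ -> _} := HB.pack l lM.
apply: (twice_diff_linear_comp (l := L)); exact: linear_mx_continuous.
Qed.

Lemma twice_diff_cV (R : realType) (V : normedModType R) (p : nat) (F : V -> 'cV[R]_p) :
  (forall i, twice_diff (fun z => F z i 0)) -> twice_diff F.
Proof.
move=> DF; rewrite (_ : F = fun z => \sum_i F z i 0 *: evec R i); last first.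
  by apply/funext => z; exact: cV_sum_evec.
rewrite /index_enum; elim: (Finite.enum _) => [|i s ih].
  under eq_fun do rewrite big_nil.
  split=> [z|v z]; first exact: differentiable_cst.
  rewrite (_ : 'D_v _ = cst 0); first exact: differentiable_cst.
  by apply/funext => y; exact: derive_cst.
under eq_fun do rewrite big_cons; apply: twice_diffD => //.
have ll : linear (fun t : R => t *: evec R i).
  by move=> a s' t; rewrite scalerDl scalerA.
pose lM := GRing.isLinear.Build _ _ _ _ _ ll.
pose L : {linear R -> 'cV[R]_p} := HB.pack (fun t : R => t *: evec R i) lM.
apply: (twice_diff_linear_comp (l := L)) => //; exact: scalel_continuous.
Qed.

(** Coordinates of [F] reduce this to the scalar-valued composition. *)
Lemma twice_diff_comp_cV (R : realType) (V : normedModType R) (m p : nat)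
    (F : 'cV[R]_m -> 'cV[R]_p) (G : V -> 'cV[R]_m) :
  twice_diff F -> twice_diff G -> twice_diff (fun z => F (G z)).
Proof.
move=> DF DG; apply: twice_diff_cV => i.
apply: (twice_diff_comp (F := fun y => F y i 0)) => //.
apply: (twice_diff_linear_mx (l := fun M : 'cV[R]_p => M i 0)) => //.
by move=> a s t; rewrite !mxE.
Qed.

Lemma twice_diff_fst (R : realType) (U V : normedModType R) : twice_diff (@fst U V).
Proof.
have ll : linear (@fst U V) by [].
pose lM := GRing.isLinear.Build _ _ _ _ _ ll.
pose L : {linear (U * V)%type -> U} := HB.pack (@fst U V) lM.
by apply: (twice_diff_linear (l := L)) => z; exact: cvg_fst.
Qed.

Lemma diff_fst (R : realType) (U V : normedModType R) (z v : U * V) :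
  'd (@fst U V) z v = v.1.
Proof.
have ll : linear (@fst U V) by [].
pose lM := GRing.isLinear.Build _ _ _ _ _ ll.
pose L : {linear (U * V)%type -> U} := HB.pack (@fst U V) lM.
have cL : continuous L by move=> y; exact: cvg_fst.
by rewrite (diff_lin _ cL).
Qed.

(** * Jacobians, Hamiltonians and the transformed constraint *)

Lemma dotc_linear (R : realType) m (c : 'cV[R]_m) : linear (dotc c).
Proof. by move=> a s t; rewrite /dotc linearP !mxE. Qed.

Lemma jacE (R : realType) (m p : nat) (F : 'cV[R]_m -> 'cV[R]_p) x v :
  differentiable F x -> jac F x *m v = 'd F x v.
Proof.
move=> dF; rewrite {2}(cV_sum_evec v) linear_sum; apply/matrixP => i j.
rewrite ord1 summxE mxE; apply: eq_bigr => k _.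
rewrite linearZ /= mxE -deriveE// derive_mx; last exact: diff_derivable.
by rewrite !mxE mulrC.
Qed.

Lemma jac_pair (R : realType) (m q p : nat)
    (f : 'cV[R]_m -> 'cV[R]_q -> 'cV[R]_p) x u (dx : 'cV[R]_m) (du : 'cV[R]_q) :
  let F z := f z.1 z.2 in
  differentiable F (x, u) ->
  jac (f^~ u) x *m dx + jac (f x) u *m du = 'd F (x, u) (dx, du).
Proof.
move=> F dF.
have d1 : differentiable (f^~ u) x.
  by apply: (differentiable_comp (f := fun y => (y, u)) (g := F)).
have d2 : differentiable (f x) u.
  by apply: (differentiable_comp (f := fun y => (x, y)) (g := F)).
rewrite !jacE// -!deriveE// (derive_fst F) (derive_snd F) !deriveE// -linearD.
by congr ('d F _ _); congr pair; rewrite /= ?addr0 ?add0r.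
Qed.

Lemma shifted_twice_diff (R : realType) (n q : nat)
  (f : 'cV[R]_(n + n) -> 'cV[R]_q -> 'cV[R]_(n + n)) fq fv :
  twice_diff (fun z : 'cV[R]_(n + n) * 'cV[R]_q => f z.1 z.2) ->
  (forall x u, f x u = col_mx (fq x) (fv x u)) ->
  twice_diff (g_of fq) /\
  twice_diff (fun z : 'cV[R]_(n + n) * 'cV[R]_q => shifted f (g_of fq) z.1 z.2).
Proof.
move=> Df fE.
have Dg : twice_diff (g_of fq).
  (* Regularity is given for [f], so [fq] is recovered as the upper half of [f] at the control 0. *)
  rewrite (_ : g_of fq = fun x => col_mx (usubmx (f x 0)) 0); last first.
    by apply/funext => x; rewrite fE col_mxKu.
  apply: (twice_diff_linear_mx (l := fun M => col_mx (usubmx M) 0)) (twice_diff_pairl 0 Df).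
  by move=> a s t; rewrite scale_col_mx add_col_mx linearP scaler0 addr0.
split; first exact: Dg.
have D1 : twice_diff (fun z : 'cV[R]_(n + n) * 'cV[R]_q => z.1 + f z.1 z.2).
  by apply: twice_diffD => //; exact: twice_diff_fst.
by apply: twice_diffD => //; exact: twice_diff_comp_cV.
Qed.

(** Grouping the constraint of the SOSC by the linearized step [dx + (J dx + K du)] exposes the
    chain rule for [y + g y] followed by [phi]. *)
Lemma chain_mulmx (R : realType) (m q p : nat) (A : 'M[R]_(p, m))
    (B J : 'M[R]_m) (K : 'M[R]_(m, q)) (dx : 'cV[R]_m) (du : 'cV[R]_q) :
  A *m (1%:M + B) *m (1%:M + J) *m dx + A *m (1%:M + B) *m K *m du
  = A *m (dx + (J *m dx + K *m du) + B *m (dx + (J *m dx + K *m du))).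
Proof.
have -> : dx + (J *m dx + K *m du) = (1%:M + J) *m dx + K *m du.
  by rewrite mulmxDl mul1mx addrA.
rewrite -!mulmxA -!mulmxDr; congr (_ *m _).
by rewrite [in LHS]mulmxDl mul1mx.
Qed.

(** The chain rule through [G], the next state, then [S], which adds [g] of it, then [phi]. *)
Lemma jac_shifted (R : realType) (n q p : nat)
  (f : 'cV[R]_(n + n) -> 'cV[R]_q -> 'cV[R]_(n + n)) g
  (phi : 'cV[R]_(n + n) -> 'cV[R]_p) x u dx du :
  let F z := f z.1 z.2 in
  (forall z, differentiable F z) -> (forall z, differentiable g z) ->
  (forall z, differentiable phi z) ->
  let A := jac phi (shifted f g x u) in
  let B := jac g (x + f x u) in
  A *m (1%:M + B) *m (1%:M + jac (f^~ u) x) *m dx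
  + A *m (1%:M + B) *m jac (f x) u *m du
  = 'd (fun z => phi (shifted f g z.1 z.2)) (x, u) (dx, du).
Proof.
move=> F dF dg dphi A B.
pose G z : 'cV[R]_(n + n) := z.1 + F z.
have dG z : differentiable G z.
  by apply: differentiableD; [exact: (twice_diff_fst _ _).1|exact: dF].
pose S z := G z + g (G z).
have dgG z : differentiable (fun z => g (G z)) z.
  exact: (differentiable_comp (dG z)).
have dS z : differentiable S z by exact: differentiableD.
have d1 z : differentiable (@fst 'cV[R]_(n + n) 'cV[R]_q) z.
  exact: (twice_diff_fst _ _).1.
have EG : 'd G (x, u) (dx, du) = dx + 'd F (x, u) (dx, du).
  have E : 'd G (x, u) (dx, du)
      = 'd (@fst 'cV[R]_(n + n) 'cV[R]_q) (x, u) (dx, du) + 'd F (x, u) (dx, du).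
    exact: (congr1 (@^~ (dx, du)) (diffD (d1 (x, u)) (dF (x, u)))).
  exact: (etrans E (congr1 (+%R^~ _) (diff_fst _ _))).
have ES : 'd S (x, u) (dx, du)
  = 'd G (x, u) (dx, du) + 'd g (G (x, u)) ('d G (x, u) (dx, du)).
  have E1 : 'd S (x, u) (dx, du)
      = 'd G (x, u) (dx, du) + 'd (fun z => g (G z)) (x, u) (dx, du).
    exact: (congr1 (@^~ (dx, du)) (diffD (dG (x, u)) (dgG (x, u)))).
  have E2 : 'd (fun z => g (G z)) (x, u) (dx, du)
      = 'd g (G (x, u)) ('d G (x, u) (dx, du)).
    exact: (congr1 (@^~ (dx, du)) (diff_comp (dG (x, u)) (dg _))).
  exact: (etrans E1 (congr1 (+%R _) E2)).
have E3 : 'd (fun z => phi (shifted f g z.1 z.2)) (x, u) (dx, du)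
  = 'd phi (S (x, u)) ('d S (x, u) (dx, du)).
  exact: (congr1 (@^~ (dx, du)) (diff_comp (dS (x, u)) (dphi _))).
pose w := dx + (jac (f^~ u) x *m dx + jac (f x) u *m du).
have Ew : w = 'd G (x, u) (dx, du).
  exact: (etrans (congr1 (+%R dx) (jac_pair dx du (dF (x, u)))) (esym EG)).
have ES' : w + B *m w = 'd S (x, u) (dx, du).
  refine (etrans (congr1 (fun v => v + B *m v) Ew) (etrans _ (esym ES))).
  exact: (congr1 (+%R _) (jacE _ (dg _))).
have EA : A *m (w + B *m w) = 'd phi (S (x, u)) ('d S (x, u) (dx, du)).
  exact: (etrans (congr1 (mulmx A) ES') (jacE _ (dphi _))).
exact: (etrans (chain_mulmx _ _ _ _ _ _) (etrans EA (esym E3))).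
Qed.

Lemma Ham_twice_diff (R : realType) (nx nu : nat) (L : 'cV[R]_nx -> 'cV[R]_nu -> R)
    (f : 'cV[R]_nx -> 'cV[R]_nu -> 'cV[R]_nx) lam :
  twice_diff (fun z : 'cV[R]_nx * 'cV[R]_nu => L z.1 z.2) ->
  twice_diff (fun z : 'cV[R]_nx * 'cV[R]_nu => f z.1 z.2) ->
  twice_diff (fun z : 'cV[R]_nx * 'cV[R]_nu => Ham L f lam z.1 z.2).
Proof.
by move=> DL Df; apply: twice_diffD => //; apply: twice_diff_linear_mx => //; exact: dotc_linear.
Qed.

(** The control at stage [k-1] reaches only the velocity of [x_k]: its generalized coordinate is
    that of [x_{k-1}] plus [fq x_{k-1}], and adding [g] produces the same coordinate. The velocities
    may differ, but [phi] does not see them. *)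
Lemma phi_stage_shifted (R : realType) (n nu nc N k : nat) (hk : (2 <= k <= N)%N)
  (f : 'cV[R]_(n + n) -> 'cV[R]_nu -> 'cV[R]_(n + n))
  (fq : 'cV[R]_(n + n) -> 'cV[R]_n)
  (fv : 'cV[R]_(n + n) -> 'cV[R]_nu -> 'cV[R]_n)
  (phi : 'cV[R]_(n + n) -> 'cV[R]_nc) (xbar : 'cV[R]_(n + n)) x u :
  (forall x u, f x u = col_mx (fq x) (fv x u)) ->
  (forall x y : 'cV[R]_(n + n), usubmx x = usubmx y -> phi x = phi y) ->
  dynamics f xbar x u ->
  phi (x (stage hk)) = phi (shifted f (g_of fq) (x (cur (stage2 hk))) (u (stage2 hk))).
Proof.
move=> fE phi_q [dyn _]; apply: phi_q.
have dE i : x (nxt i) = x (cur i) + f (x (cur i)) (u i).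
  by apply/esym/eqP; rewrite -subr_eq0 dyn.
have [k2 kN] := andP hk; have k0 : (0 < k)%N by exact: ltnW.
have k1 : (k.-1 < N)%N by rewrite prednK.
(* Stage [k-1] is both the end of the step from [k-2] and the start of the step to [k]. *)
have e1 : cur (Ordinal k1) = nxt (stage2 hk).
  by apply/val_inj; rewrite /= /bump /= add1n -[in LHS](subnK k2) addn2.
have e2 : stage hk = nxt (Ordinal k1).
  by apply/val_inj; rewrite /= /bump /= add1n prednK.
rewrite e2 dE e1 dE /shifted /g_of; set y := x (cur (stage2 hk)) + _.
by rewrite (fE y) !linearD /= !col_mxKu.
Qed.

Lemma qformZ (R : realType) m (Q : 'M[R]_m) t z :
  qform Q (t *: z) = t ^+ 2 * qform Q z.
Proof.
rewrite /qform; have -> : (t *: z)^T = t *: z^T.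
  by apply/matrixP => i j; rewrite !mxE.
by rewrite -scalemxAr -!scalemxAl scalerA mxE -expr2.
Qed.

Lemma qform_continuous (R : realType) (V : normedModType R) m (Q : 'M[R]_m)
    (l : V -> 'cV[R]_m) :
  continuous l -> continuous (fun d => qform Q (l d)).
Proof.
move=> cl; have cc i : continuous (fun d => l d i 0).
  move=> d; apply: (@continuous_comp _ _ _ l (fun M : 'cV[R]_m => M i 0)).
    exact: cl.
  exact: coord_continuous.
rewrite (_ : (fun d => _) =
    fun d => \sum_j (\sum_i l d i 0 * Q i j) * l d j 0); last first.
  apply/funext => d; rewrite /qform mxE; apply: eq_bigr => j _.
  by rewrite mxE; congr (_ * _); apply: eq_bigr => i _; rewrite mxE.
apply: continuous_sum => j d; apply: cvgM; last exact: cc.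
apply: continuous_sum => i {}d; apply: cvgM; [exact: cc|exact: cvg_cst].
Qed.

Lemma linear_fun_mx_continuous (R : realType) (W : normedModType R) (p q : nat)
    (l : 'M[R]_(p, q) -> W) : linear l -> continuous l.
Proof.
move=> ll; pose lM := GRing.isLinear.Build _ _ _ _ _ ll.
pose L : {linear _ -> _} := HB.pack l lM; exact: (linear_mx_continuous (l := L)).
Qed.

(** * Trajectories as vectors *)

Section trajectory_coordinates.
Context {R : realType} {nx nu N : nat}.
Notation D := 'rV[R]_(nx * N.+1 + nu * N).

Definition dstate (i : 'I_N.+1) (d : D) : 'cV[R]_nx :=
  \col_a d 0 (lshift _ (mxvec_index a i)).
Definition dcontrol (i : 'I_N) (d : D) : 'cV[R]_nu :=
  \col_a d 0 (rshift _ (mxvec_index a i)).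
(** Flattening a whole trajectory into one row vector gives access to the minimum over the unit
    sphere in [second_order_sufficient]. *)
Definition displacement (X : 'I_N.+1 -> 'cV[R]_nx) (U : 'I_N -> 'cV[R]_nu) : D :=
  row_mx (mxvec (\matrix_(a, i) X i a 0)) (mxvec (\matrix_(a, i) U i a 0)).

Lemma dstateK X U i : dstate i (displacement X U) = X i.
Proof.
by apply/colP => a; rewrite mxE row_mxEl mxvecE mxE.
Qed.

Lemma dcontrolK X U i : dcontrol i (displacement X U) = U i.
Proof.
by apply/colP => a; rewrite mxE row_mxEr mxvecE mxE.
Qed.

(** The max norm of the flattened vector is what makes its balls match the boxes in
    [strict_local_min]. *)
Lemma displacement_norm X U e : 0 < e -> (forall i, `|X i| < e) ->
  (forall i, `|U i| < e) -> `|displacement X U| < e.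
Proof.
move=> e0 hX hU; apply: mx_norm_lt => // z j; rewrite ord1.
case: (split_ordP j) => k ->; rewrite ?row_mxEl ?row_mxEr;
  case/mxvec_indexP: k => a i; rewrite mxvecE mxE;
  exact: le_lt_trans (ler_norm_mx _ _ _) _.
Qed.

Lemma displacement0 (d : D) :
  (forall i, dstate i d = 0) -> (forall i, dcontrol i d = 0) -> d = 0.
Proof.
move=> hX hU; apply/rowP => j; rewrite mxE.
case: (split_ordP j) => k ->; case/mxvec_indexP: k => a i.
- by have /colP/(_ a) := hX i; rewrite !mxE.
- by have /colP/(_ a) := hU i; rewrite !mxE.
Qed.

Lemma dstate_linear i : linear (dstate i).
Proof. by move=> t d e; apply/colP => a; rewrite !mxE. Qed.

Lemma dcontrol_linear i : linear (dcontrol i).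
Proof. by move=> t d e; apply/colP => a; rewrite !mxE. Qed.

Lemma dstate0 i : dstate i 0 = 0.
Proof. by apply/colP => a; rewrite !mxE. Qed.

Lemma dcontrol0 i : dcontrol i 0 = 0.
Proof. by apply/colP => a; rewrite !mxE. Qed.

Lemma dstate_norm i d : `|dstate i d| <= `|d|.
Proof. by apply: mx_norm_le => // a b; rewrite mxE ler_norm_mx. Qed.

Lemma dcontrol_norm i d : `|dcontrol i d| <= `|d|.
Proof. by apply: mx_norm_le => // a b; rewrite mxE ler_norm_mx. Qed.

End trajectory_coordinates.

(** * Expansion of the cost at feasible displacements *)

(** The sum of [G] over all [N+1] indices is split at its first index, leaving the [nxt], and at its
    last, leaving the [cur]. *)
Lemma telescope_ord (R : realType) (N : nat) (G : 'I_N.+1 -> R) :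
  \sum_(i < N) (G (nxt i) - G (cur i)) = G ord_max - G ord0.
Proof.
have E : G ord0 + \sum_(i < N) G (nxt i) = \sum_(i < N) G (cur i) + G ord_max.
  by rewrite -big_ord_recl big_ord_recr.
rewrite sumrB; move: E; move: (\sum_i _) (\sum_i _) => s t; lra.
Qed.

Lemma dotcBr (R : realType) m (a b c : 'cV[R]_m) :
  dotc a (b - c) = dotc a b - dotc a c.
Proof. by rewrite /dotc mulmxBr !mxE. Qed.

Lemma dotcBl (R : realType) m (a b c : 'cV[R]_m) :
  dotc (a - b) c = dotc a c - dotc b c.
Proof. by rewrite /dotc linearB mulmxBl !mxE. Qed.

Lemma grad_dotc (R : realType) m (h : 'cV[R]_m -> R) (x c a : 'cV[R]_m) :
  (grad h x)^T = a -> (grad h x *m c) 0 0 = dotc a c.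
Proof. by move=> <-; rewrite /dotc trmxK. Qed.

(** Kept in the exact shape of the SOSC, without the Taylor factor [2^-1], so that the hypothesis
    applies by conversion. *)
Definition quadratic_part (R : realType) (nx nu N : nat)
  (varphi : 'cV[R]_nx -> R) (h : 'I_N -> 'cV[R]_nx -> 'cV[R]_nu -> R)
  (x dx : 'I_N.+1 -> 'cV[R]_nx) (u du : 'I_N -> 'cV[R]_nu) : R :=
  qform (hess varphi (x ord_max)) (dx ord_max) +
  \sum_(i < N) qform (Qblock (h i) (x (cur i)) (u i))
                     (col_mx (dx (cur i)) (du i)).

Definition second_order_rem (R : realType) (nx nu N : nat)
  (varphi : 'cV[R]_nx -> R) (h : 'I_N -> 'cV[R]_nx -> 'cV[R]_nu -> R)
  (x dx : 'I_N.+1 -> 'cV[R]_nx) (u du : 'I_N -> 'cV[R]_nu) : R :=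
  taylor_rem varphi (x ord_max) (dx ord_max) +
  \sum_(i < N) taylor_rem_pair (h i) (x (cur i)) (u i) (dx (cur i)) (du i).

(* The multipliers cancel by telescoping, the initial displacement being zero. *)
Lemma cost_expansion (R : realType) (nx nu N : nat)
  (varphi : 'cV[R]_nx -> R) (L : 'cV[R]_nx -> 'cV[R]_nu -> R)
  (h : 'I_N -> 'cV[R]_nx -> 'cV[R]_nu -> R)
  (lam x dx : 'I_N.+1 -> 'cV[R]_nx) (u du : 'I_N -> 'cV[R]_nu) :
  dx ord0 = 0 ->
  (forall i, h i (x (cur i)) (u i)
     = L (x (cur i)) (u i) + dotc (lam (nxt i)) (x (nxt i) - x (cur i))) ->
  (forall i, h i (x (cur i) + dx (cur i)) (u i + du i)
     = L (x (cur i) + dx (cur i)) (u i + du i) +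
       dotc (lam (nxt i)) (x (nxt i) + dx (nxt i) - (x (cur i) + dx (cur i)))) ->
  (grad varphi (x ord_max))^T - lam ord_max = 0 ->
  (forall i, (grad (h i ^~ (u i)) (x (cur i)))^T + lam (nxt i) - lam (cur i) = 0) ->
  (forall i, (grad (h i (x (cur i))) (u i))^T = 0) ->
  cost varphi L (fun i => x i + dx i) (fun i => u i + du i) - cost varphi L x u
  = 2^-1 * quadratic_part varphi h x dx u du
    + second_order_rem varphi h x dx u du.
Proof.
move=> dx0 hE hE' gN gx gu.
rewrite /cost /quadratic_part /second_order_rem /taylor_rem /taylor_rem_pair.
have -> : (grad varphi (x ord_max) *m dx ord_max) 0 0 = dotc (lam ord_max) (dx ord_max).
  by apply: grad_dotc; apply/eqP; rewrite -subr_eq0; apply/eqP.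
(* By stationarity the state gradient is [lam (cur i) - lam (nxt i)] and the control gradient is
   zero; combined with [lam (nxt i)] paired with the change of the state step, this leaves a
   difference of consecutive products. *)
have E i : h i (x (cur i) + dx (cur i)) (u i + du i)
       - h i (x (cur i)) (u i)
       - (grad (h i ^~ (u i)) (x (cur i)) *m dx (cur i)) 0 0
       - (grad (h i (x (cur i))) (u i) *m du i) 0 0
    = (L (x (cur i) + dx (cur i)) (u i + du i) - L (x (cur i)) (u i))
      + (dotc (lam (nxt i)) (dx (nxt i)) - dotc (lam (cur i)) (dx (cur i))).
  rewrite (grad_dotc _ (a := lam (cur i) - lam (nxt i))); last first.
    by apply/eqP; rewrite -subr_eq0 opprB addrA gx.
  rewrite (grad_dotc _ (gu i)) dotcBl hE hE' !dotcBr.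
  have -> : dotc 0 (du i) = 0 by rewrite /dotc trmx0 mul0mx mxE.
  have dD (v w z : 'cV[R]_nx) : dotc v (w + z) = dotc v w + dotc v z.
    by rewrite /dotc mulmxDr mxE.
  rewrite !dD; ring.
under [X in _ = _ + (_ + X)]eq_bigr do rewrite E.
(* The surviving term at the last stage cancels the gradient term of [varphi]. *)
rewrite sumrB big_split /= (telescope_ord (fun i => dotc (lam i) (dx i))).
rewrite -mulr_sumr sumrB.
rewrite dx0 (_ : dotc (lam ord0) 0 = 0); last by rewrite /dotc mulmx0 mxE.
move: (\sum_i _) (\sum_i _) (\sum_i _) => s1 s2 s3.
move: (varphi _) (varphi _) (qform _ _) (dotc _ _) => v1 v2 q1 d1.
by field.
Qed.

Lemma linear_scale (R : realType) (V W : lmodType R) (l : V -> W) t v :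
  linear l -> l (t *: v) = t *: l v.
Proof.
move=> ll; pose lM := GRing.isLinear.Build _ _ _ _ _ ll.
pose L : {linear _ -> _} := HB.pack l lM; exact: (linearZ_LR L).
Qed.

(** On a feasible trajectory [f] is the state increment and the [mult] term vanishes. This serves
    twice: at the candidate and at its feasible displacements. *)
Lemma stage_Ham_feasible (R : realType) (nx nu nc N k : nat)
  (hk : (2 <= k <= N)%N) (L : 'cV[R]_nx -> 'cV[R]_nu -> R)
  (f : 'cV[R]_nx -> 'cV[R]_nu -> 'cV[R]_nx) g (phi : 'cV[R]_nx -> 'cV[R]_nc)
  lam mult xbar x u i :
  feasible_transformed hk f g phi xbar x u ->
  stage_Ham hk L f g phi lam mult i (x (cur i)) (u i)
  = L (x (cur i)) (u i) + dotc (lam (nxt i)) (x (nxt i) - x (cur i)).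
Proof.
move=> [[dyn _] ph0].
have -> : x (nxt i) - x (cur i) = f (x (cur i)) (u i).
  by apply/eqP; rewrite subr_eq addrC eq_sym -subr_eq0 dyn.
rewrite /stage_Ham; case: eqP => [->|_//]; rewrite /Ham_tilde ph0.
by rewrite /dotc mulmx0 mxE addr0.
Qed.

Lemma stage_Ham_twice_diff (R : realType) (nx nu nc N k : nat)
  (hk : (2 <= k <= N)%N) (L : 'cV[R]_nx -> 'cV[R]_nu -> R)
  (f : 'cV[R]_nx -> 'cV[R]_nu -> 'cV[R]_nx) g (phi : 'cV[R]_nx -> 'cV[R]_nc)
  lam mult (i : 'I_N) :
  twice_diff (fun z : 'cV[R]_nx * 'cV[R]_nu => L z.1 z.2) ->
  twice_diff (fun z : 'cV[R]_nx * 'cV[R]_nu => f z.1 z.2) ->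
  twice_diff (fun z : 'cV[R]_nx * 'cV[R]_nu => phi (shifted f g z.1 z.2)) ->
  twice_diff (fun z : 'cV[R]_nx * 'cV[R]_nu =>
        stage_Ham hk L f g phi lam mult i z.1 z.2).
Proof.
move=> DL Df Dphi; have DH := Ham_twice_diff (lam (nxt i)) DL Df.
rewrite /stage_Ham; case: ifP => _; last exact: DH.
apply: (twice_diffD DH); apply: twice_diff_linear_mx; [exact: dotc_linear|exact: Dphi].
Qed.

(* [F], [P] and [h] are the dynamics, the transformed constraint and the
   Hamiltonians as functions of one stage. *)
Lemma second_order_trajectory (R : realType) (nx nu nc N : nat)
  (F : 'cV[R]_nx * 'cV[R]_nu -> 'cV[R]_nx) (P : 'cV[R]_nx * 'cV[R]_nu -> 'cV[R]_nc)
  (varphi : 'cV[R]_nx -> R) (h : 'I_N -> 'cV[R]_nx -> 'cV[R]_nu -> R) (j : 'I_N)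
  (x : 'I_N.+1 -> 'cV[R]_nx) (u : 'I_N -> 'cV[R]_nu)
  (J : 'rV[R]_(nx * N.+1 + nu * N) -> R) (feas : 'rV[R]_(nx * N.+1 + nu * N) -> Prop) :
  (forall z, differentiable F z) -> (forall z, differentiable P z) ->
  twice_diff varphi -> (forall i, twice_diff (fun z => h i z.1 z.2)) ->
  (forall i, F (x (cur i), u i) = x (nxt i) - x (cur i)) ->
  P (x (cur j), u j) = 0 ->
  (forall d, feas d ->
    [/\ dstate ord0 d = 0,
        forall i, F (x (cur i) + dstate (cur i) d, u i + dcontrol i d)
          = x (nxt i) + dstate (nxt i) d - (x (cur i) + dstate (cur i) d) &
        P (x (cur j) + dstate (cur j) d, u j + dcontrol j d) = 0]) ->
  (forall d, feas d -> J d
     = 2^-1 * quadratic_part varphi h x (dstate^~ d) u (dcontrol^~ d)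
       + second_order_rem varphi h x (dstate^~ d) u (dcontrol^~ d)) ->
  (forall (dx : 'I_N.+1 -> 'cV[R]_nx) (du : 'I_N -> 'cV[R]_nu),
    ~ ((forall i, dx i = 0) /\ (forall i, du i = 0)) ->
    dx ord0 = 0 ->
    (forall i : 'I_N,
       dx (cur i) + 'd F (x (cur i), u i) (dx (cur i), du i) - dx (nxt i) = 0) ->
    'd P (x (cur j), u j) (dx (cur j), du j) = 0 ->
    0 < quadratic_part varphi h x dx u du) ->
  \forall d \near (0 : 'rV[R]_(nx * N.+1 + nu * N)), feas d -> d != 0 -> 0 < J d.
Proof.
move=> dF dP Dphi Dh Fx Px Fed JE pos.
pose dp i (d : 'rV[R]_(nx * N.+1 + nu * N)) := (dstate (cur i) d, dcontrol i d).
have dp_norm i d : `|dp i d| <= `|d|.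
  by rewrite prod_norm_le dstate_norm dcontrol_norm.
have dp_linear i : linear (dp i).
  by move=> t d e; congr pair; [exact: dstate_linear|exact: dcontrol_linear].
pose lin i d := dstate (cur i) d + 'd F (x (cur i), u i) (dp i d) - dstate (nxt i) d.
have lin_linear i : linear (lin i).
  move=> t d e; rewrite /lin !dstate_linear.
  rewrite (_ : 'd F _ _ = t *: 'd F (x (cur i), u i) (dp i d)
                        + 'd F (x (cur i), u i) (dp i e)); last first.
    exact: (etrans (congr1 _ (dp_linear i t d e)) (linearP _ _ _ _)).
  by rewrite scalerBr scalerDr [X in X - _]addrACA opprD [LHS]addrACA.
pose linP d := 'd P (x (cur j), u j) (dp j d).
have linP_linear : linear linP.
  move=> t d e; exact: (etrans (congr1 _ (dp_linear j t d e)) (linearP _ _ _ _)).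
pose a d := `|dstate ord0 d| + \sum_i `|lin i d| + `|linP d|.
pose Q d := 2^-1 * quadratic_part varphi h x (dstate^~ d) u (dcontrol^~ d).
pose remF i q := `|F ((x (cur i), u i) + q) - F (x (cur i), u i)
                   - 'd F (x (cur i), u i) q|.
pose remP q := `|P ((x (cur j), u j) + q) - P (x (cur j), u j)
                   - 'd P (x (cur j), u j) q|.
have qcol_linear i : linear (fun d : 'rV[R]_(nx * N.+1 + nu * N) =>
    col_mx (dstate (cur i) d) (dcontrol i d)).
  by move=> t d e; rewrite dstate_linear dcontrol_linear scale_col_mx add_col_mx.
(* The second remainder is left to unification with [JE], which makes it [second_order_rem]. *)
apply: (@second_order_sufficient R _ Q a _ _ _ _ _ _ J
   (fun d => \sum_i remF i (dp i d) + remP (dp j d))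
   (fun d => _) feas _ _ _ JE).
- have c1 : continuous (fun d : 'rV[R]_(nx * N.+1 + nu * N) =>
      qform (hess varphi (x ord_max)) (dstate ord_max d)).
    apply: qform_continuous; apply: linear_fun_mx_continuous; exact: dstate_linear.
  have c2 : continuous (fun d : 'rV[R]_(nx * N.+1 + nu * N) =>
      \sum_(i < N) qform (Qblock (h i) (x (cur i)) (u i))
                         (col_mx (dstate (cur i) d) (dcontrol i d))).
    apply: continuous_sum => i; apply: qform_continuous.
    by apply: linear_fun_mx_continuous; exact: qcol_linear.
  by move=> d; apply: cvgMl_tmp; [exact: nbhs_filter|exact: (cvgD (c1 d) (c2 d))].
- have cn (W : normedModType R) (l : 'rV[R]_(nx * N.+1 + nu * N) -> W) :
      linear l -> continuous (fun d => `|l d|).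
    by move=> /linear_fun_mx_continuous cl d; exact: cvg_norm (cl d).
  have c0 := cn _ _ (dstate_linear ord0).
  have c1 : continuous (fun d => \sum_i `|lin i d|).
    by apply: continuous_sum => i; apply: cn; exact: lin_linear.
  have c2 := cn _ _ linP_linear.
  by move=> d; exact: (cvgD (cvgD (c0 d) (c1 d)) (c2 d)).
- move=> t d; rewrite /Q /quadratic_part (linear_scale _ _ (dstate_linear _)) qformZ.
  rewrite [RHS]mulrCA [X in _ = _ * X]mulrDr mulr_sumr; congr (_ * (_ + _)).
  by apply: eq_bigr => i _; rewrite (linear_scale _ _ (qcol_linear i)) qformZ.
- move=> t d; rewrite /a (linear_scale _ _ (dstate_linear _)).
  rewrite (linear_scale _ _ linP_linear) !normrZ !mulrDr mulr_sumr.
  congr (_ + _ + _); apply: eq_bigr => i _.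
  by rewrite (linear_scale _ _ (lin_linear i)) normrZ.
- move=> d d0 /eqP; rewrite /a !paddr_eq0 ?addr_ge0 ?sumr_ge0// !normr_eq0.
  rewrite psumr_eq0//.
  move=> /andP[/andP[/eqP d00 /allP linE] /eqP linPE].
  rewrite /Q mulr_gt0 ?invr_gt0//; apply: pos.
  - by move=> [h1 h2]; move/eqP: d0; apply; exact: displacement0.
  - exact: d00.
  - move=> i; apply/eqP; have := linE i (mem_index_enum i).
    by rewrite /= normr_eq0.
  - exact: linPE.
- by move=> d; rewrite !addr_ge0// sumr_ge0.
- apply: negligibleD.
    apply: negligible_sum => i; apply: (negligible_comp (l := dp i)) => //.
    exact: negligible_diff.
  apply: (negligible_comp (l := dp j)) => //; exact: negligible_diff.
- apply: negligibleD.
    exact: (negligible_comp (@dstate_norm _ _ _ _ ord_max) (taylor2 (x ord_max) Dphi)).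
  apply: negligible_sum => i.
  exact: (negligible_comp (dp_norm i) (taylor2_pair (x (cur i)) (u i) (Dh i))).
(* For feasible [d] the exact constraints hold before and after displacement, so each linearized
   constraint equals minus its first-order error; the bound is in fact an equality. *)
- move=> d /Fed[d0 dyn ph0]; rewrite ger0_norm; last first.
    by rewrite addr_ge0 ?sumr_ge0// => *; exact: normr_ge0.
  rewrite /a d0 normr0 add0r; apply: lerD.
    apply: ler_sum => i _; rewrite /remF -[leRHS]normrN.
    rewrite le_eqVlt; apply/orP; left; apply/eqP; congr (`|_|).
    have E : F ((x (cur i), u i) + dp i d) =
        x (nxt i) + dstate (nxt i) d - (x (cur i) + dstate (cur i) d) := dyn i.
    rewrite /lin; move: ('d F _ _) => v; rewrite E Fx.
    by apply/matrixP => a1 b1; rewrite !mxE; ring.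
  rewrite /remP -[leRHS]normrN.
  rewrite le_eqVlt; apply/orP; left; apply/eqP; congr (`|_|).
  have E : P ((x (cur j), u j) + dp j d) = 0 := ph0.
  by rewrite E Px subrr sub0r opprK.
Qed.

Theorem proposition4p3 (R : realType) (n nu nc N k : nat)
  (n_gt0 : (0 < n)%N) (nu_gt0 : (0 < nu)%N) (nc_gt0 : (0 < nc)%N)
  (nu_le_n : (nu <= n)%N) (nc_le_n : (nc <= n)%N)
  (hk : (2 <= k <= N)%N)
  (varphi : 'cV[R]_(n + n) -> R)
  (L : 'cV[R]_(n + n) -> 'cV[R]_nu -> R)
  (f : 'cV[R]_(n + n) -> 'cV[R]_nu -> 'cV[R]_(n + n))
  (fq : 'cV[R]_(n + n) -> 'cV[R]_n)
  (fv : 'cV[R]_(n + n) -> 'cV[R]_nu -> 'cV[R]_n)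
  (phi : 'cV[R]_(n + n) -> 'cV[R]_nc)
  (xbar : 'cV[R]_(n + n))
  (varphi_C2 : C2 varphi)
  (L_C2 : C2 (fun z : 'cV[R]_(n + n) * 'cV[R]_nu => L z.1 z.2))
  (f_C2 : C2 (fun z : 'cV[R]_(n + n) * 'cV[R]_nu => f z.1 z.2))
  (phi_C2 : C2 phi)
  (f_form : forall x u, f x u = col_mx (fq x) (fv x u))
  (phi_q : forall x y : 'cV[R]_(n + n), usubmx x = usubmx y -> phi x = phi y)
  (x : 'I_N.+1 -> 'cV[R]_(n + n)) (u : 'I_N -> 'cV[R]_nu)
  (lam : 'I_N.+1 -> 'cV[R]_(n + n)) (mult : 'cV[R]_nc) :
  SOSC_transformed hk varphi L f (g_of fq) phi xbar x u lam mult ->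
  strict_local_min hk varphi L f phi xbar x u.
Proof.
move=> [[[dyn ph0] gN gx gu] pos].
have DF := C2_twice_diff f_C2.
have [Dg DS] := shifted_twice_diff DF f_form.
have DPS := twice_diff_comp_cV (C2_twice_diff phi_C2) DS.
have dynE (a b c : 'cV[R]_(n + n)) : a + b - c = 0 -> b = c - a.
  by move=> /eqP; rewrite subr_eq0 => /eqP <-; rewrite addrAC subrr add0r.
have xE i : f (x (cur i)) (u i) = x (nxt i) - x (cur i) := dynE _ _ _ (dyn.1 i).
(* At the candidate the stage constraint passes from the transformed problem to the original one;
   for competitors [FeT] goes the other way. *)
split; first by split=> //; rewrite (phi_stage_shifted hk f_form phi_q dyn).
pose feas (d : 'rV[R]_((n + n) * N.+1 + nu * N)) := feasible hk f phi xbar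
  (fun i => x i + dstate i d) (fun i => u i + dcontrol i d).
have FeT d : feas d -> feasible_transformed hk f (g_of fq) phi xbar
    (fun i => x i + dstate i d) (fun i => u i + dcontrol i d).
  by move=> [dyn' ph]; split=> //; rewrite -(phi_stage_shifted hk f_form phi_q dyn').
have Fe0 d : feas d -> dstate ord0 d = 0.
  move=> [[_ x0] _]; move: x0; have [_ x0] := dyn.
  by rewrite addrAC x0 add0r.
pose h i := stage_Ham hk L f (g_of fq) phi lam mult i.
pose J (d : 'rV[R]_((n + n) * N.+1 + nu * N)) :=
  cost varphi L (fun i => x i + dstate i d) (fun i => u i + dcontrol i d)
  - cost varphi L x u.
pose F (z : 'cV[R]_(n + n) * 'cV[R]_nu) := f z.1 z.2.
pose P (z : 'cV[R]_(n + n) * 'cV[R]_nu) := phi (shifted f (g_of fq) z.1 z.2).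
have [] := @nbhs_ballP _ _ (0 : 'rV[R]_((n + n) * N.+1 + nu * N))
    (fun d => feas d -> d != 0 -> 0 < J d).
have key : nbhs (0 : 'rV[R]_((n + n) * N.+1 + nu * N))
    (fun d => feas d -> d != 0 -> 0 < J d).
  apply: (@second_order_trajectory R _ _ _ N F P varphi h (stage2 hk) x u J feas).
  - exact: DF.1.
  - exact: DPS.1.
  - exact: C2_twice_diff.
  - move=> i; exact: (stage_Ham_twice_diff hk lam mult i (C2_twice_diff L_C2) DF DPS).
  - exact: xE.
  - exact: ph0.
  - move=> d Fd; have [[dyn' _] ph'] := FeT d Fd; split=> //; first exact: Fe0.
    by move=> i; exact: dynE (dyn' i).
  - move=> d Fd; apply: (@cost_expansion _ _ _ _ _ _ h lam) (Fe0 d Fd) _ _ gN gx gu.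
      by move=> i; exact: (stage_Ham_feasible L lam mult i (conj dyn ph0)).
    by move=> i; exact: (stage_Ham_feasible L lam mult i (FeT d Fd)).
  (* The Jacobian products of the SOSC are rewritten as the differentials of [F] and [P]. *)
  - move=> dx du nz dx0 lindyn linphi; apply: pos => //.
      move=> i; rewrite mulmxDl mul1mx -[X in X - _]addrA.
      by rewrite (jac_pair _ _ (DF.1 (x (cur i), u i))) lindyn.
    by rewrite (jac_shifted _ _ _ _ DF.1 Dg.1 (C2_twice_diff phi_C2).1) linphi.
move=> /(_ key)[e /= e0 he] _; exists e => // x' u' xe ue fe neq.
pose d := displacement (fun i => x' i - x i) (fun i => u' i - u i).
have xd : (fun i => x i + dstate i d) = x'.
  by apply/funext => i; rewrite dstateK addrC subrK.
have ud : (fun i => u i + dcontrol i d) = u'.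
  by apply/funext => i; rewrite dcontrolK addrC subrK.
have := he d; rewrite /feas /J xd ud subr_gt0; apply=> //.
  rewrite -ball_normE /= sub0r normrN; exact: displacement_norm.
apply/eqP => d0; apply: neq; split=> i.
- by have := congr1 (@^~ i) xd; rewrite /= d0 dstate0 addr0.
- by have := congr1 (@^~ i) ud; rewrite /= d0 dcontrol0 addr0.
Qed.
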